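(* Let $1\le p<\infty$, let $A(u)$ be a pairwise commuting family of positive definite $n\times n$ matrices ($u$ runs over the support of $\Phi$), and suppose $(\det A(u))^{-1/p}\Phi(u)\in L^1(\Omega)$. Then the Hausdorff operator $\mathcal{H}_{\Phi,A}$ is noncompact in $L^p(\mathbb{R}^n)$ provided it is non-zero.
   Context: Setting: $(\Omega,\mu)$ is a $\sigma$-compact locally compact topological space endowed with a positive regular Borel measure $\mu$; $\Phi$ is a (complex-valued) locally integrable function on $\Omega$; $(A(u))_{u\in\Omega}$ is a $\mu$-measurable family of real $n\times n$ matrices defined almost everywhere in the support of $\Phi$ and satisfying $\det A(u)\neq 0$. The Hausdorff operator with kernel $\Phi$ is $$(\mathcal{H}_{\Phi,A}f)(x)=\int_\Omega \Phi(u)f(A(u)x)\,d\mu(u),$$ where $x\in\mathbb{R}^n$ is a column vector. ''Positive definite'' means real symmetric positive definite. Under the stated integrability condition $\mathcal{H}_{\Phi,A}$ is a bounded operator on $L^p(\mathbb{R}^n)$. *)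

(* Defs.v *)
From HB Require Import structures.
From mathcomp Require Import all_boot all_order all_algebra.
From mathcomp Require Import all_classical all_reals all_analysis.
From mathcomp Require Import measurable_realfun.
From mathcomp Require Import complex.

Set Implicit Arguments.
Unset Strict Implicit.
Unset Printing Implicit Defensive.

Import Order.TTheory GRing.Theory Num.Theory.
Import numFieldNormedType.Exports.
Import ComplexField.Normc.

Local Open Scope classical_set_scope.
Local Open Scope ring_scope.
Local Open Scope complex_scope.

(* The Borel sigma-algebra of a topological space, as a measurable type on the
   same carrier. *)
Definition borel (T : topologicalType) := g_sigma_algebraType (@open T).

Definition mx_display : measure_display -> measure_display.
Proof. exact. Qed.

Definition complex_display : measure_display -> measure_display.
Proof. exact. Qed.

(* Matrices (in particular column vectors) carry the sigma-algebra generated by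
   the entries, i.e. the Borel sigma-algebra of the Euclidean space. *)
Section matrix_measurable.
Variables (R : realType) (m n : nat).

Definition mx_entries : set (set 'M[R]_(m, n)) :=
  \bigcup_(ij in [set: 'I_m * 'I_n])
    preimage_set_system setT (fun M : 'M[R]_(m, n) => M ij.1 ij.2) measurable.

Let mx0 : <<s mx_entries >> set0. Proof. exact: sigma_algebra0. Qed.
Let mxC A : <<s mx_entries >> A -> <<s mx_entries >> (~` A).
Proof. exact: sigma_algebraC. Qed.
Let mxU (F : (set 'M[R]_(m, n))^nat) : (forall i, <<s mx_entries >> (F i)) ->
  <<s mx_entries >> (\bigcup_i F i).
Proof. exact: sigma_algebra_bigcup. Qed.

HB.instance Definition _ :=
  @isMeasurable.Build (mx_display default_measure_display) 'M[R]_(m, n)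
    <<s mx_entries >> mx0 mxC mxU.

End matrix_measurable.

(* The Borel sigma-algebra of the complex plane, generated by Re and Im. *)
Section complex_measurable.
Variable R : realType.

HB.instance Definition _ := isPointed.Build R[i] 0.

Local Notation G := (g_sigma_preimageU (@complex.Re R) (@complex.Im R)).
Let c0 : G set0. Proof. exact: sigma_algebra0. Qed.
Let cC A : G A -> G (~` A). Proof. exact: sigma_algebraC. Qed.
Let cU (F : (set R[i])^nat) : (forall i, G (F i)) -> G (\bigcup_i F i).
Proof. exact: sigma_algebra_bigcup. Qed.

HB.instance Definition _ := @isMeasurable.Build
  (complex_display default_measure_display) R[i] G c0 cC cU.
End complex_measurable.

Lemma measurable_complexP d (T : measurableType d) (R : realType)
    (f : T -> R[i]) :
  measurable_fun setT f <->
  measurable_fun setT (@complex.Re R \o f) /\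
  measurable_fun setT (@complex.Im R \o f).
Proof.
split=> [mf|[mr mi]].
  split; apply: measurableT_comp => // _ Y mY; rewrite setTI;
    apply: sub_sigma_algebra; [left|right]; exists Y => //; by rewrite setTI.
move=> _; apply: (@measurability _ _ _ _ _ _
   (preimage_set_system setT (@complex.Re R) measurable `|`
    preimage_set_system setT (@complex.Im R) measurable)) => //.
move=> _ [_ [[Y mY <-]|[Y mY <-]] <-]; rewrite !setTI.
  by rewrite -[X in measurable X]setTI; exact: mr.
by rewrite -[X in measurable X]setTI; exact: mi.
Qed.

Lemma measurable_mxP d (T : measurableType d) (R : realType) m n
    (f : T -> 'M[R]_(m, n)) :
  measurable_fun setT f <->
  forall i j, measurable_fun setT (fun t => f t i j).
Proof.
split=> [mf i j|mf].
  apply: (@measurableT_comp _ _ _ _ _ _ (fun M : 'M[R]_(m, n) => M i j)) => //.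
  move=> _ Y mY; rewrite setTI; apply: sub_sigma_algebra.
  by exists (i, j) => //; exists Y => //; rewrite setTI.
move=> _; apply: (@measurability _ _ _ _ _ _ (@mx_entries R m n)) => //.
move=> _ [_ [[i j] _ [Y mY <-]] <-]; rewrite !setTI.
rewrite -[X in measurable X]setTI; exact: mf.
Qed.

Lemma measurable_entry (R : realType) m n i j :
  measurable_fun setT (fun M : 'M[R]_(m, n) => M i j).
Proof.
by have /(_ (@measurable_id _ _ _)) := (measurable_mxP (@id 'M[R]_(m, n))).1.
Qed.

(* Lebesgue measure on the Borel sets of R^n (column vectors), built by
   iterating the product with the one-dimensional Lebesgue measure; its value on
   boxes is lebesgue_cV_box below. *)
Section lebesgue_cV.
Variable R : realType.

Definition cV_cons n (xv : measurableTypeR R * 'cV[R]_n) : 'cV[R]_n.+1 :=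
  col_mx (const_mx xv.1 : 'cV_1) xv.2.

Let cV_uncons n (v : 'cV[R]_n.+1) : measurableTypeR R * 'cV[R]_n :=
  (v ord0 ord0, dsubmx (v : 'cV_(1 + n))).

Let cV_consK n : cancel (@cV_cons n) (@cV_uncons n).
Proof.
move=> [x v]; rewrite /cV_uncons /cV_cons /= col_mxKd; congr (_, _).
have -> : (ord0 : 'I_n.+1) = lshift n (ord0 : 'I_1) by exact: val_inj.
by rewrite (@col_mxEu _ 1 n) mxE.
Qed.

Lemma measurable_cV_cons n : measurable_fun setT (@cV_cons n).
Proof.
apply/measurable_mxP => i j; rewrite (ord1 j).
have [k|k] := split_ordP (i : 'I_(1 + n)) => ->.
  rewrite (_ : (fun t => _) = fst); first exact: measurable_fst.
  by apply/funext => t; rewrite /cV_cons (@col_mxEu _ 1 n) mxE.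
rewrite (_ : (fun t => _) = (fun v : 'cV[R]_n => v k ord0) \o snd).
  by apply: measurableT_comp; [exact: measurable_entry|exact: measurable_snd].
by apply/funext => t; rewrite /cV_cons /= (@col_mxEd _ 1 n).
Qed.

Let measurable_cV_uncons n : measurable_fun setT (@cV_uncons n).
Proof.
apply/measurable_fun_pairP; split; first exact: measurable_entry.
apply/measurable_mxP => i j /=; under eq_fun do rewrite mxE.
exact: measurable_entry.
Qed.

Section step.
Variables (n : nat) (mu : {sigma_finite_measure set 'cV[R]_n -> \bar R}).

Definition lebesgue_cVS : set 'cV[R]_n.+1 -> \bar R :=
  pushforward (@lebesgue_measure R \x mu)%E (@cV_cons n).

Let cVS0 : lebesgue_cVS set0 = 0%E.
Proof. by rewrite /lebesgue_cVS /pushforward preimage_set0 measure0. Qed.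

Let cVS_ge0 A : (0 <= lebesgue_cVS A)%E.
Proof. by rewrite /lebesgue_cVS /pushforward; exact: measure_ge0. Qed.

Let cVS_sigma_additive : semi_sigma_additive lebesgue_cVS.
Proof.
move=> F mF tF mUF; rewrite /lebesgue_cVS /pushforward preimage_bigcup.
apply: measure_semi_sigma_additive.
- by move=> k; rewrite -[X in measurable X]setTI; exact: measurable_cV_cons.
- apply/trivIsetP => /= i j _ _ ij; rewrite -preimage_setI.
  by move/trivIsetP : tF => /(_ _ _ _ _ ij) ->//; rewrite preimage_set0.
- rewrite -preimage_bigcup -[X in measurable X]setTI.
  exact: measurable_cV_cons.
Qed.

HB.instance Definition _ := isMeasure.Build _ _ _ lebesgue_cVS
  cVS0 cVS_ge0 cVS_sigma_additive.

Let sf : sigma_finite setT lebesgue_cVS.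
Proof.
have /sigma_finiteP[F [FT ndF Ffin]] := sigma_finiteT (@lebesgue_measure R).
have /sigma_finiteP[G [GT ndG Gfin]] := sigma_finiteT mu.
exists (fun k => @cV_uncons n @^-1` (F k `*` G k)).
  rewrite -preimage_bigcup (_ : \bigcup_k _ = setT) ?preimage_setT//.
  rewrite -subTset => -[x v] _.
  have [k _ Fkx] : (\bigcup_k F k) x by rewrite -FT.
  have [l _ Glv] : (\bigcup_k G k) v by rewrite -GT.
  exists (maxn k l) => //; split.
  - by move: x Fkx; exact/subsetPset/ndF/leq_maxl.
  - by move: v Glv; exact/subsetPset/ndG/leq_maxr.
move=> k; have [mF Fk] := Ffin k; have [mG Gk] := Gfin k; split.
  rewrite -[X in measurable X]setTI; apply: measurable_cV_uncons => //.
  exact: measurableX.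
rewrite /lebesgue_cVS /pushforward -comp_preimage.
rewrite (_ : _ \o _ = id); last by apply/funext => x; exact: cV_consK.
by rewrite preimage_id product_measure1E// lte_mul_pinfty// ge0_fin_numE.
Qed.

HB.instance Definition _ := Measure_isSigmaFinite.Build _ _ _ lebesgue_cVS sf.
End step.

Fixpoint lebesgue_cV n : {sigma_finite_measure set 'cV[R]_n -> \bar R} :=
  match n with
  | 0 => dirac (0 : 'cV[R]_0)
  | n.+1 => lebesgue_cVS (lebesgue_cV n)
  end.
End lebesgue_cV.

Lemma lebesgue_cV_box (R : realType) n (A : 'I_n -> set R) :
  (forall i, measurable (A i)) ->
  lebesgue_cV R n [set v | forall i, A i (v i ord0)] =
  (\prod_(i < n) lebesgue_measure (A i))%E.
Proof.
elim: n A => [|n IH] A mA.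
  by rewrite big_ord0 /= diracE mem_set//= => -[].
have mB : measurable [set v : 'cV[R]_n | forall i, A (lift ord0 i) (v i ord0)].
  rewrite (_ : mkset _ = \bigcap_(i in [set: 'I_n])
      ((fun v : 'cV[R]_n => v i ord0) @^-1` A (lift ord0 i))); last first.
    by apply/seteqP; split=> v /= h i *; exact: h.
  apply: fin_bigcap_measurable => // i _; rewrite -[X in measurable X]setTI.
  by apply: measurable_entry => //; exact: mA.
rewrite big_ord_recl -IH// -product_measure1E//; last exact: mA.
rewrite /= /lebesgue_cVS /pushforward; apply: congr1.
apply/seteqP; split=> -[x v] /=.
  move=> h; split=> [|i].
  have := h ord0.
  have -> : (ord0 : 'I_n.+1) = lshift n (ord0 : 'I_1) by exact: val_inj.
  by rewrite /cV_cons (@col_mxEu _ 1 n) mxE.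
  have := h (lift ord0 i).
  have e : lift ord0 i = rshift 1 i by exact: val_inj.
  by rewrite {2}e /cV_cons (@col_mxEd _ 1 n).
move=> [h0 h] i.
have [j ->|j ->] := @split_ordP 1 n i.
  rewrite /cV_cons (@col_mxEu _ 1 n) mxE.
  have -> : lshift n j = (ord0 : 'I_n.+1) by rewrite (ord1 j); exact: val_inj.
  exact: h0.
rewrite /cV_cons (@col_mxEd _ 1 n).
have -> : rshift 1 j = lift (ord0 : 'I_n.+1) j by exact: val_inj.
exact: h.
Qed.

Lemma measurable_normc (R : realType) : measurable_fun setT (@normc R).
Proof.
have /(_ (@measurable_id _ _ _)) [mr mi] := (measurable_complexP (@id R[i])).1.
rewrite (_ : @normc R = (fun x : R[i] =>
    Num.sqrt (complex.Re x ^+ 2 + complex.Im x ^+ 2))); last by apply/funext => -[].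
have ms := continuous_measurable_fun (@sqrt_continuous R).
apply: (measurableT_comp ms).
by apply: measurable_funD; exact: measurable_funX.
Qed.

Lemma measurable_complexB d (T : measurableType d) (R : realType)
    (f g : T -> R[i]) : measurable_fun setT f -> measurable_fun setT g ->
  measurable_fun setT (f \- g).
Proof.
move=> /measurable_complexP[fr fi] /measurable_complexP[gr gi].
apply/measurable_complexP; split.
  rewrite (_ : _ \o _ = (@complex.Re R \o f) \- (@complex.Re R \o g)).
    exact: measurable_funB.
  by apply/funext => x /=; case: (f x) (g x) => ? ? [].
rewrite (_ : _ \o _ = (@complex.Im R \o f) \- (@complex.Im R \o g)).
  exact: measurable_funB.
by apply/funext => x /=; case: (f x) (g x) => ? ? [].
Qed.

Definition Lp_norm (R : realType) (n : nat) (p : R)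
    (f : 'cV[R]_n -> R[i]) : \bar R :=
  ('N[lebesgue_cV R n]_p%:E[EFin \o (@normc R \o f)])%E.

(* The space L^p(R^n) of complex-valued functions, as classes modulo a.e.
   equality; an element coerces to a representative. The argument p1 makes the
   metric below canonical. *)
Record Lp (R : realType) (n : nat) (p : R) (p1 : 1 <= p) := MkLp {
  Lp_class :> {mfun_ (lebesgue_cV R n), 'cV[R]_n >-> R[i]} ;
  Lp_finite : (Lp_norm p Lp_class < +oo)%E }.

Section Lp_theory.
Variables (R : realType) (n : nat) (p : R) (p1 : 1 <= p).
Local Notation Lp := (@Lp R n p p1).
Local Notation Lp_norm := (@Lp_norm R n p).

HB.instance Definition _ := gen_eqMixin Lp.
HB.instance Definition _ := gen_choiceMixin Lp.

Definition Lp_ball (F : Lp) (e : R) (G : Lp) : Prop :=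
  (Lp_norm (F \- G)%R < e%:E)%E.

Lemma measurable_Lp (F : Lp) : measurable_fun setT (F : _ -> _).
Proof. exact: measurable_funPT. Qed.

Lemma Lp_norm_triangle (f g h : 'cV[R]_n -> R[i]) :
  measurable_fun setT f -> measurable_fun setT g -> measurable_fun setT h ->
  (Lp_norm (f \- h)%R <= Lp_norm (f \- g)%R + Lp_norm (g \- h)%R)%E.
Proof.
move=> mf mg mh.
have mn (u v : 'cV[R]_n -> R[i]) :
    measurable_fun setT u -> measurable_fun setT v ->
    measurable_fun setT (fun x => normc ((u \- v) x)).
  move=> mu mv; apply: measurableT_comp (@measurable_normc R) _.
  exact: measurable_complexB.
have := @minkowski_EFin _ _ _ (lebesgue_cV R n) _ _ p
  (mn _ _ mf mg) (mn _ _ mg mh) p1.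
apply: le_trans.
have nc0 (z : R[i]) : 0 <= normc z by case: z => a b; exact: sqrtr_ge0.
have p0 : 0 <= p by rewrite (le_trans _ p1).
rewrite /Lp_norm unlock.
have i0 (u : 'cV[R]_n -> R) :
    (0 <= \int[lebesgue_cV R n]_x `|(EFin \o u) x| `^ p)%E.
  by apply: integral_ge0 => x _; exact: poweR_ge0.
apply: gt0_ler_poweR; rewrite ?invr_ge0//.
- by rewrite in_itv/= leey andbT; exact: i0.
- by rewrite in_itv/= leey andbT; exact: i0.
have mpow (u : 'cV[R]_n -> R) : measurable_fun setT u ->
    measurable_fun setT (fun x => (`|(EFin \o u) x| `^ p)%E).
  move=> mu; apply: (measurableT_comp (measurable_poweR _)).
  have mEu : measurable_fun setT (EFin \o u) by exact/measurable_EFinP.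
  exact: measurableT_comp mEu.
apply: ge0_le_integral => //.
- by move=> x _; exact: poweR_ge0.
- exact: (mpow (fun x => normc ((f \- h) x)) (mn f h mf mh)).
- have := mpow (fun x => normc ((f \- g) x) + normc ((g \- h) x)).
  by apply; apply: measurable_funD; [exact: (mn f g)|exact: (mn g h)].
move=> x _; rewrite /= lee_fin.
rewrite !ger0_norm ?addr_ge0//.
apply: ge0_ler_powR; rewrite ?nnegrE ?addr_ge0//.
by rewrite (_ : f x - h x = (f x - g x) + (g x - h x)) ?le_normcD// addrA subrK.
Qed.

Lemma Lp_norm_cst0 : Lp_norm (cst 0) = 0%E.
Proof.
rewrite /Lp_norm (_ : _ \o _ = cst 0%E); last first.
  by apply/funext => x /=; rewrite expr0n /= addr0 sqrtr0.
by rewrite Lnorm0// eqe gt_eqF// (lt_le_trans _ p1).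
Qed.

Lemma Lp_ball_center F (e : R) : 0 < e -> Lp_ball F e F.
Proof.
move=> e0; rewrite /Lp_ball (_ : _ \- _ = cst 0) ?Lp_norm_cst0 ?lte_fin//.
by apply/funext => x /=; rewrite subrr.
Qed.

Lemma Lp_ball_sym F G (e : R) : Lp_ball F e G -> Lp_ball G e F.
Proof.
rewrite /Lp_ball /Lp_norm.
rewrite (_ : @normc R \o (F \- G) = @normc R \o (G \- F))//.
by apply/funext => x /=; rewrite -opprB normcN.
Qed.

Lemma Lp_ball_triangle F G H (e1 e2 : R) :
  Lp_ball F e1 G -> Lp_ball G e2 H -> Lp_ball F (e1 + e2) H.
Proof.
move=> FG GH; rewrite /Lp_ball EFinD.
apply: (le_lt_trans (@Lp_norm_triangle F G H _ _ _)); try exact: measurable_Lp.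
exact: lteD.
Qed.

HB.instance Definition _ := hasNbhs.Build Lp (nbhs_ (entourage_ Lp_ball)).
HB.instance Definition _ := Nbhs_isPseudoMetric.Build R Lp
  erefl Lp_ball_center Lp_ball_sym Lp_ball_triangle erefl.

Lemma eq_ae_Lp_norm (f g : 'cV[R]_n -> R[i]) :
  measurable_fun setT f -> measurable_fun setT g ->
  f = g %[ae lebesgue_cV R n] -> Lp_norm f = Lp_norm g.
Proof.
have mpow (u : 'cV[R]_n -> R[i]) : measurable_fun setT u ->
    measurable_fun setT (fun x => (`|(EFin \o (@normc R \o u)) x| `^ p)%E).
  move=> mu; apply: (measurableT_comp (measurable_poweR _)).
  have mEu : measurable_fun setT (EFin \o (@normc R \o u)).
    apply/measurable_EFinP.
    exact: (measurableT_comp (@measurable_normc R) mu).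
  exact: measurableT_comp mEu.
move=> mf mg fg; rewrite /Lp_norm unlock; congr (_ `^ _)%E.
apply: ae_eq_integral => //; [exact: mpow|exact: mpow|].
by apply: filterS fg => x /= + _ => ->.
Qed.

Local Notation Q := {mfun_ (lebesgue_cV R n), 'cV[R]_n >-> R[i]}.

Lemma Lp_of_finite (f : {mfun 'cV[R]_n >-> R[i]}) : (Lp_norm f < +oo)%E ->
  (Lp_norm (\pi_Q%qT f : Q) < +oo)%E.
Proof.
set F : Q := \pi_Q%qT f => fp; rewrite (@eq_ae_Lp_norm _ f)//.
have /eqmodP/asboolP : (repr F = f %[mod Q])%qT by rewrite reprK.
by [].
Qed.

Definition Lp_of (f : {mfun 'cV[R]_n >-> R[i]})
    (fp : (Lp_norm f < +oo)%E) : Lp :=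
  MkLp p1 (Lp_of_finite fp).

Lemma LpP (F G : Lp) : F = G <-> (F : _ -> _) = G %[ae lebesgue_cV R n].
Proof.
split=> [->|FG]; first exact: (ae_eq_refl _ setT).
have FGc : Lp_class F = Lp_class G.
  by apply/eqP; rewrite -[Lp_class F]reprK -[Lp_class G]reprK; exact/ae_eqP.
case: F G FG FGc => F Ff [G Gf] _ /= FG; subst G.
by congr MkLp; exact: Prop_irrelevance.
Qed.

Lemma Lp_norm_cst0_finite : (Lp_norm (cst 0%R) < +oo)%E.
Proof. by rewrite Lp_norm_cst0. Qed.

Definition Lp0 : Lp := @Lp_of (cst 0) Lp_norm_cst0_finite.

Lemma Lp0E : (Lp0 : _ -> _) = cst 0 %[ae lebesgue_cV R n].
Proof.
by have /eqmodP/asboolP : (repr (Lp_class Lp0) =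
  (cst 0 : {mfun 'cV[R]_n >-> R[i]}) %[mod Q])%qT by rewrite reprK.
Qed.

End Lp_theory.

(* The image of the closed unit ball is relatively compact in L^p. *)
Definition compact_operator (R : realType) (n : nat) (p : R) (p1 : 1 <= p)
    (T : Lp n p1 -> Lp n p1) : Prop :=
  precompact (T @` [set F : Lp n p1 | (Lp_norm p F <= 1)%E]).

Definition sigma_compact (T : topologicalType) : Prop :=
  exists2 K : (set T)^nat, (forall k, compact (K k)) & \bigcup_k K k = [set: T].

Section hausdorff.
Variables (R : realType) (Omega : ptopologicalType).
Variable mu : {measure set (borel Omega) -> \bar R}.
Implicit Types (D K U : set Omega) (Phi : Omega -> R[i]).

Local Notation borel_set := (@measurable _ (borel Omega)).

(* Compact sets are only assumed Borel here because Omega is not assumed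
   Hausdorff. *)
Definition regular_borel : Prop :=
  [/\ forall K, compact K -> borel_set K -> (mu K < +oo)%E,
      forall B, borel_set B ->
        mu B = ereal_inf [set mu U | U in [set U | open U /\ B `<=` U]]
    & forall U, open U ->
        mu U = ereal_sup
          [set mu K | K in [set K | [/\ compact K, borel_set K & K `<=` U]]]].

(* Measurability on D with respect to the completion of mu: equality almost
   everywhere on D with a Borel function. *)
Definition mu_measurable d (T : measurableType d) D (f : Omega -> T) : Prop :=
  exists2 g : borel Omega -> T, measurable_fun [set: borel Omega] g &
    (f : borel Omega -> T) = g %[ae mu in D].

Definition integrableC D (f : Omega -> R[i]) : Prop :=
  mu_measurable D f /\
  (\int[mu]_(u in (D : set (borel Omega))) (normc (f u))%:E < +oo)%E.

Definition locally_integrableC Phi : Prop :=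
  mu_measurable [set: Omega] Phi /\
  forall K, compact K -> borel_set K -> integrableC K Phi.

(* The Lebesgue integral is total: outside the integrable case the value is
   meaningless. *)
Definition integralC (f : Omega -> R[i]) : R[i] :=
  (\int[mu]_u complex.Re (f u))%R +i* (\int[mu]_u complex.Im (f u))%R.

(* The measure-theoretic support: Phi is only relevant up to null sets, so this
   is not the topological closure. *)
Definition supp Phi : set Omega := [set u | Phi u != 0].

Variable n : nat.

Definition hausdorff Phi (A : Omega -> 'M[R]_n) (f : 'cV[R]_n -> R[i]) :
    'cV[R]_n -> R[i] :=
  fun x => integralC (fun u => Phi u * f (A u *m x)).

(* The class of hausdorff Phi A F; the default value Lp0 is used only when that
   function has no class in L^p. *)
Definition hausdorff_op (p : R) (p1 : 1 <= p) Phi (A : Omega -> 'M[R]_n)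
    (F : Lp n p1) : Lp n p1 :=
  xget (Lp0 n p1) [set G : Lp n p1 |
    (G : 'cV[R]_n -> R[i]) = hausdorff Phi A F %[ae lebesgue_cV R n]].

End hausdorff.

Definition posdefmx (R : realType) (n : nat) (M : 'M[R]_n) : Prop :=
  M^T = M /\ forall x : 'cV[R]_n, x != 0 -> 0 < (x^T *m M *m x) ord0 ord0.

(* Main.v *)
From HB Require Import structures.
Require Import Defs.
From mathcomp Require Import all_boot all_order all_algebra.
From mathcomp Require Import all_classical all_reals all_analysis.
From mathcomp Require Import complex.
From mathcomp Require Import measurable_realfun ring lra.
Set Implicit Arguments.
Unset Strict Implicit.
Unset Printing Implicit Defensive.
Import Order.TTheory GRing.Theory Num.Theory.
Import numFieldNormedType.Exports.
Import ComplexField.Normc.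
Local Open Scope classical_set_scope.
Local Open Scope ring_scope.
Local Open Scope complex_scope.

(* The matrices A(u) commute with the scalar dilations x |-> t x, hence so does
   H = H_{Phi,A}. If G = H F is nonzero, put F_t(x) = a t^{n/p} F(t x) with a > 0
   small: these lie in the unit ball, and H F_t(x) = a t^{n/p} G(t x) has constant
   positive norm while its mass concentrates at the origin as t grows, so the
   family H F_t has no cluster point in L^p.

   Elements of L^p are classes, so the dilation identity for H must survive a
   change of representative: for a null set N, Fubini shows that for almost every
   x one has A(u) x \notin N for almost every u in the support of Phi. *)

(** * Lebesgue measure under dilations and translations *)

(** Both sides are measures in [E], so by uniqueness of Lebesgue measure it is enough to compare
    them on half-open intervals. *)
Lemma lebesgue_measure_affine (R : realType) (t b : R) (E : set R) :
  0 < t -> measurable E ->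
  (t%:E * lebesgue_measure ((fun x : R => (t * x + b)%R) @^-1` E) =
   lebesgue_measure E)%E.
Proof.
move=> t0 mE.
pose f := (fun x : R => t * x + b) : measurableTypeR R -> measurableTypeR R.
have mf : measurable_fun setT f.
  by apply: measurable_funD => //; exact: measurable_funM.
pose c : {nonneg R} := NngNum (ltW t0).
suff /(_ mf E mE) : forall E, measurable E ->
    lebesgue_measure E = mscale c (pushforward (@lebesgue_measure R) f) E by [].
move=> mf'; apply: lebesgue_measure_unique => //= _ [[x y]] _ <-.
rewrite /mscale/= /pushforward.
have -> : f @^-1` [set` `]x, y]] = [set` `]((x - b) / t), ((y - b) / t)]].
  apply/seteqP; split=> z /=; rewrite !in_itv/=;
    by rewrite ltr_pdivrMr// ler_pdivlMr// ltrBlDr lerBrDr mulrC.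
rewrite !lebesgue_measure_itv/= !lte_fin ltr_pM2r ?invr_gt0// ltrD2r.
case: ifPn => _; last by rewrite mule0.
by rewrite -!EFinB -EFinM; congr EFin; field; rewrite gt_eqF.
Qed.

Lemma measurable_cV_affine (R : realType) n (t : R) (b : 'cV[R]_n) :
  measurable_fun setT (fun v : 'cV[R]_n => t *: v + b).
Proof.
apply/measurable_mxP => i j; under eq_fun do rewrite !mxE.
by apply: measurable_funD => //; apply: measurable_funM => //;
  exact: measurable_entry.
Qed.

(** Induction on the dimension: the map acts separately on the first coordinate and on the rest, so
    uniqueness of the product measure reduces the claim to rectangles. With [t = 1] it gives
    translation invariance, with [b = 0] the scaling law. *)
Lemma lebesgue_cV_affine (R : realType) n (t : R) (b : 'cV[R]_n)
    (E : set 'cV[R]_n) : 0 < t -> measurable E ->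
  ((t ^+ n)%:E * lebesgue_cV R n ((fun v => (t *: v + b)%R) @^-1` E) =
   lebesgue_cV R n E)%E.
Proof.
move=> t0; elim: n b E => [|n IH] b E mE.
  rewrite expr0 mul1e; congr (lebesgue_cV R 0 _).
  by apply/funext => v /=; rewrite [t *: v + b]flatmx0 [in RHS](flatmx0 v).
pose b0 := b ord0 ord0; pose b' : 'cV[R]_n := dsubmx (b : 'cV_(1 + n)).
pose phi := fun x : measurableTypeR R => (t * x + b0 : measurableTypeR R).
pose psi := fun xv : measurableTypeR R * 'cV[R]_n =>
  (phi xv.1, t *: xv.2 + b').
have mphi : measurable_fun setT phi.
  by apply: measurable_funD => //; exact: measurable_funM.
have mpsi : measurable_fun setT psi.
  apply/measurable_fun_pairP; split.
    by apply: (measurableT_comp mphi); exact: measurable_fst.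
  apply: (measurableT_comp (measurable_cV_affine t b')); exact: measurable_snd.
have tn0 : 0 <= t ^+ n.+1 by rewrite exprn_ge0// ltW.
pose P := (@lebesgue_measure R \x lebesgue_cV R n)%E.
have mc : measurable (@cV_cons R n @^-1` E).
  by rewrite -[X in measurable X]setTI; exact: measurable_cV_cons.
have /(_ mpsi) -> : lebesgue_cV R n.+1 E =
    mscale (NngNum tn0) (pushforward P psi) (@cV_cons R n @^-1` E).
  move=> mpsi'; apply: product_measure_unique => // A B mA mB.
  transitivity ((t ^+ n.+1)%:E *
    P ((phi @^-1` A) `*` ((fun v => t *: v + b')%R @^-1` B)))%E; first by [].
  rewrite /P product_measure1E//; last first.
  - by rewrite -[X in measurable X]setTI; exact: measurable_cV_affine.
  - by rewrite -[X in measurable X]setTI; exact: mphi.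
  rewrite exprS EFinM muleACA; congr (_ * _)%E; last exact: IH.
  exact: lebesgue_measure_affine.
congr (_ * P _)%E.
apply/funext => -[x v] /=; congr E.
apply/colP => i; rewrite /cV_cons.
have [k ->|k ->] := @split_ordP 1 n i.
  rewrite (@col_mxEu _ 1 n) [RHS]mxE [LHS]mxE [X in X + _]mxE (@col_mxEu _ 1 n) mxE.
  by rewrite (ord1 k); congr (_ + b _ _); exact: val_inj.
by rewrite !mxE (unsplitK (inr k) : fintype.split (rshift 1 k) = _) /= !mxE.
Qed.

(** * Null sets: Fubini and invertible linear maps *)

(** The measures of the sections integrate to the same value in either order, and a nonnegative
    measurable function has zero integral exactly when it vanishes almost everywhere. *)
Lemma ae_null_ysection d1 d2 (T1 : measurableType d1) (T2 : measurableType d2)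
    (R : realType) (m1 : {sigma_finite_measure set T1 -> \bar R})
    (m2 : {sigma_finite_measure set T2 -> \bar R}) (M : set (T1 * T2)) :
  measurable M -> (\forall x \ae m1, m2 (xsection M x) = 0%E) ->
  \forall y \ae m2, m1 (ysection M y) = 0%E.
Proof.
move=> mM null1.
have fub : (\int[m1]_x m2 (xsection M x) = \int[m2]_y m1 (ysection M y))%E.
  transitivity ((m1 \x^ m2) M)%E; last by [].
  apply: (product_measure_unique (m1 := m1) (m2 := m2)
    (m' := product_measure2 m1 m2)) => // A B mA mB.
  exact: product_measure2E.
have int0 : (\int[m2]_y `|m1 (ysection M y)| = 0)%E.
  under eq_integral do rewrite gee0_abs//.
  rewrite -fub.
  under eq_integral do rewrite -[m2 _]gee0_abs//.
  apply/ae_eq_integral_abs => //; first exact: measurable_fun_xsection.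
  by apply: filterS null1 => x.
have /ae_eq_integral_abs : measurable_fun setT (m1 \o ysection M).
  exact: measurable_fun_ysection.
move=> /(_ m2 measurableT)[/(_ int0) + _].
by apply: filterS => y /(_ I).
Qed.

Lemma measurable_mulmx d (T : measurableType d) (R : realType) m n p
    (f : T -> 'M[R]_(m, n)) (g : T -> 'M[R]_(n, p)) :
  measurable_fun setT f -> measurable_fun setT g ->
  measurable_fun setT (fun t => f t *m g t).
Proof.
move=> /measurable_mxP mf /measurable_mxP mg.
apply/measurable_mxP => i j; under eq_fun do rewrite mxE.
by apply: measurable_sum => k; exact: measurable_funM.
Qed.

Lemma measurable_addmx d (T : measurableType d) (R : realType) m n
    (f g : T -> 'M[R]_(m, n)) :
  measurable_fun setT f -> measurable_fun setT g ->
  measurable_fun setT (fun t => f t + g t).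
Proof.
move=> /measurable_mxP mf /measurable_mxP mg.
apply/measurable_mxP => i j; under eq_fun do rewrite mxE.
exact: measurable_funD.
Qed.

Lemma lebesgue_cV_translate (R : realType) n (b : 'cV[R]_n) (E : set 'cV[R]_n) :
  measurable E ->
  lebesgue_cV R n ((fun v => v + b) @^-1` E) = lebesgue_cV R n E.
Proof.
move=> mE; rewrite -[RHS](lebesgue_cV_affine b ltr01 mE) expr1n mul1e.
by congr (lebesgue_cV R n _); apply/funext => v /=; rewrite scale1r.
Qed.

Lemma lebesgue_cV_setT_neq0 (R : realType) n :
  lebesgue_cV R n [set: 'cV[R]_n] != 0%E.
Proof.
have := @lebesgue_cV_box R n (fun=> setT) (fun=> measurableT).
rewrite (_ : mkset _ = setT); last by apply/seteqP; split.
move=> ->; elim/big_ind : _ => // [x y x0 y0|_ _].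
  by rewrite mule_eq0 negb_or x0.
by rewrite -set_itvNyy lebesgue_measure_itv.
Qed.

(* Fubini for [{(y, x) | x + M y \in N}]: all sections in [x] are translates of
   [N], and all sections in [y] are translates of the preimage of [N]. *)
Lemma lebesgue_cV_linear_null (R : realType) n (M : 'M[R]_n)
    (N : set 'cV[R]_n) : \det M != 0 -> measurable N ->
  lebesgue_cV R n N = 0%E ->
  lebesgue_cV R n ((fun v => M *m v) @^-1` N) = 0%E.
Proof.
move=> detM mN N0.
pose g := fun yx : 'cV[R]_n * 'cV[R]_n => yx.2 + M *m yx.1.
have mg : measurable_fun setT g.
  apply: measurable_addmx; first exact: measurable_snd.
  by apply: measurable_mulmx => //; exact: measurable_fst.
have mE : measurable (g @^-1` N).
  by rewrite -[X in measurable X]setTI; exact: mg.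
have [] := @ae_null_ysection _ _ _ _ _ (lebesgue_cV R n) (lebesgue_cV R n)
  (g @^-1` N) mE.
  apply: aeW => /= y; rewrite -N0 -(lebesgue_cV_translate (M *m y) mN).
  by congr (lebesgue_cV R n _); apply/seteqP; split => x; rewrite /xsection/= inE.
move=> B [mB B0 sB].
(* The whole space is not null, so some [x] lies outside the exceptional set; one good section is
   enough. *)
have [x Bx] : exists x, ~ B x.
  apply/existsNP => BT; have /eqP := lebesgue_cV_setT_neq0 R n; apply.
  by rewrite (_ : setT = B)//; apply/seteqP; split.
have null : lebesgue_cV R n (ysection (g @^-1` N) x) = 0%E.
  by apply: contra_notP Bx => nz; exact: sB.
(* Since [M (y + b) = x + M y], translating the preimage of [N] by [b] gives exactly the null
   section at [x]. *)
pose b : 'cV[R]_n := invmx M *m x.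
have Mu : M \in unitmx by rewrite unitmxE unitfE.
have mL : measurable ((fun v => M *m v) @^-1` N).
  by rewrite -[X in measurable X]setTI; apply: measurable_mulmx.
rewrite -(lebesgue_cV_translate b mL) -[RHS]null.
congr (lebesgue_cV R n _); apply/seteqP; split => y; rewrite /ysection/= inE /g/=.
  by rewrite /b mulmxDr mulKVmx// addrC.
by rewrite /b mulmxDr mulKVmx// addrC.
Qed.

(** * Comparing integrals of functions that agree almost everywhere up to a constant *)

Import HBNNSimple.

(* No measurability is assumed in the next lemmas: the integrals that define the
   Hausdorff operator have integrands that are only measurable with respect to
   the completion of [mu]. *)
Lemma ae_le_integralZ d (T : measurableType d) (R : realType)
    (mu : {measure set T -> \bar R}) (c : R) (f g : T -> \bar R) :
  0 < c -> (forall x, 0 <= f x)%E -> (forall x, 0 <= g x)%E ->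
  (\forall x \ae mu, f x <= c%:E * g x)%E ->
  (\int[mu]_x f x <= c%:E * \int[mu]_x g x)%E.
Proof.
move=> c0 f0 g0 [N [mN N0 fg]].
rewrite [leLHS]ge0_integralTE//; apply: ge_ereal_sup => _ [h hf <-].
have ci0 : 0 <= c^-1 by rewrite invr_ge0 ltW.
(* Killing a simple minorant [h] of [f] on [N] and dividing it by [c] gives a simple minorant of [g]
   everywhere, at no cost in the integral beyond the factor [c]. *)
pose h' := scale_nnsfun (proj_nnsfun h (measurableC mN)) ci0.
have h'E x : (h' x = c^-1 * (h x * \1_(~` N) x))%R by [].
have mE (k : {nnsfun T >-> R}) : measurable_fun setT (EFin \o k).
  exact/measurable_EFinP.
have -> : (sintegral mu h = c%:E * \int[mu]_x (h' x)%:E)%E.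
  rewrite -integralT_nnsfun -ge0_integralZl_EFin//; last first.
  - exact: ltW.
  - exact: mE.
  - by move=> x _; rewrite lee_fin.
  apply: ae_eq_integral => //; first exact: mE.
  - by apply: emeasurable_funM => //; exact: mE.
  exists N; split => // x /= /not_implyP[_]; apply: contra_notP => Nx.
  rewrite -EFinM -[mindic _ _ _]/(\1_(~` N) x) mulVKf ?gt_eqF//.
  by rewrite indicE mem_set ?mulr1.
rewrite lee_pmul2l//.
rewrite [leRHS]ge0_integralTE//; apply: ereal_sup_ubound; exists h'; last first.
  exact/esym/integralT_nnsfun.
move=> x; rewrite [h' x]h'E indicE; have [xN|xN] := boolP (x \in ~` N); last first.
  by rewrite !mulr0.
rewrite mulr1 EFinM lee_pdivrMl//; apply: le_trans (hf x) _.
by apply: contrapT => /fg; move: xN; rewrite inE.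
Qed.

Lemma ae_Rintegral_scale d (T : measurableType d) (R : realType)
    (mu : {measure set T -> \bar R}) (c : R) (f g : T -> R) :
  0 < c -> (\forall x \ae mu, f x = c * g x) ->
  (\int[mu]_x f x = c * \int[mu]_x g x)%R.
Proof.
move=> c0 fg.
have scale (u v : T -> \bar R) : (forall x, 0 <= u x)%E ->
    (forall x, 0 <= v x)%E -> (\forall x \ae mu, u x = c%:E * v x)%E ->
    (\int[mu]_x u x = c%:E * \int[mu]_x v x)%E.
  (* Equality follows from the one-sided lemma used twice, with [c] and with its inverse. *)
  move=> u0 v0 uv; apply/eqP; rewrite eq_le; apply/andP; split.
    by apply: ae_le_integralZ => //; apply: filterS uv => x /= ->.
  rewrite -lee_pdivlMl//; apply: ae_le_integralZ; rewrite ?invr_gt0//.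
  apply: filterS uv => x /= ->; rewrite muleA -EFinM mulVf ?mul1e//.
  by rewrite gt_eqF.
rewrite /Rintegral integralE [in RHS]integralE.
rewrite (scale (fun x => (EFin \o f)^\+ x)%E (fun x => (EFin \o g)^\+ x)%E)//; last first.
  apply: filterS fg => x /= fgx; rewrite !funeposE /= fgx.
  by rewrite maxe_pMr ?mule0// lee_fin ltW.
rewrite (scale (fun x => (EFin \o f)^\- x)%E (fun x => (EFin \o g)^\- x)%E)//; last first.
  apply: filterS fg => x /= fgx; rewrite !funenegE /= fgx.
  by rewrite -mulrN EFinM maxe_pMr ?mule0// lee_fin ltW.
(* If either part is infinite, both sides collapse to the value 0 that [fine] gives to infinities,
   so the identity survives outside the integrable case. *)
case: (integral mu setT (fun x => (EFin \o g)^\+ x)%E) => [r||];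
  case: (integral mu setT (fun x => (EFin \o g)^\- x)%E) => [q||] /=;
  rewrite ?gt0_muley ?gt0_muleNy ?lte_fin//= ?mulr0//.
by rewrite mulrBr.
Qed.

Lemma integralC_ae_scale (R : realType) (Omega : ptopologicalType)
    (mu : {measure set (borel Omega) -> \bar R}) (c : R)
    (f g : borel Omega -> R[i]) :
  0 < c -> (\forall u \ae mu, f u = c%:C * g u) ->
  integralC mu f = c%:C * integralC mu g.
Proof.
move=> c0 fg; rewrite /integralC.
rewrite (@ae_Rintegral_scale _ _ _ mu c (fun u => complex.Re (f u))
  (fun u => complex.Re (g u)))//; last first.
  by apply: filterS fg => u /= ->; case: (g u) => x y /=; rewrite mul0r subr0.
rewrite (@ae_Rintegral_scale _ _ _ mu c (fun u => complex.Im (f u))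
  (fun u => complex.Im (g u)))//; last first.
  by apply: filterS fg => u /= ->; case: (g u) => x y /=; rewrite mul0r addr0.
by apply/eqP; rewrite eq_complex /= !mul0r subr0 addr0 !eqxx.
Qed.

(** * Null sets seen along the orbits [A u *m x] *)

Lemma normc_ge0 (R : rcfType) (z : R[i]) : 0 <= normc z.
Proof. by case: z => x y; exact: sqrtr_ge0. Qed.

(** Integrability of [w] covers the set where [w] is nonzero, up to a null set, by countably many
    sets [E k] of finite measure. On each of them Fubini applies: for fixed [u] the bad [x] form the
    preimage of [N] under an invertible matrix, hence a null set. The Borel representatives [g] of
    [A] and [h] of [w] supply joint measurability. *)
Lemma ae_orbit_avoids_null (R : realType) (Omega : ptopologicalType) n
    (mu : {measure set (borel Omega) -> \bar R}) (S : set Omega)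
    (A : Omega -> 'M[R]_n) (w : borel Omega -> R[i]) (N : set 'cV[R]_n) :
  mu_measurable mu S A -> integrableC mu [set: Omega] w ->
  (\forall u \ae mu, w u != 0 -> S u) ->
  (forall u, S u -> \det (A u) != 0) ->
  measurable N -> lebesgue_cV R n N = 0%E ->
  \forall x \ae lebesgue_cV R n, \forall u \ae mu,
    w u != 0 -> ~ N (A u *m x).
Proof.
move=> [g mg Ag] [[h mh wh] wint] wS detA mN N0.
have FF : Filter (almost_everywhere mu) by exact: ae_filter_ringOfSetsType.
have {}wh : \forall u \ae mu, w u = h u.
  by apply: (@filterS _ _ FF) wh => u /(_ I).
have mnh : measurable_fun setT (fun u : borel Omega => normc (h u)).
  exact: (measurableT_comp (@measurable_normc R) mh).
have mEh : measurable_fun setT (fun u : borel Omega => (normc (h u))%:E).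
  exact/measurable_EFinP.
(* The comparison lemma with constant 1 transfers the bound from [w], which need only agree almost
   everywhere with a Borel function. *)
have hint : (\int[mu]_u (normc (h u))%:E < +oo)%E.
  apply: le_lt_trans wint.
  rewrite -[leRHS]mul1e; apply: ae_le_integralZ => // [x|x|].
  - by rewrite lee_fin normc_ge0.
  - by rewrite lee_fin normc_ge0.
  - by apply: (@filterS _ _ FF) wh => u /= ->; rewrite ?mul1e.
pose E k : set (borel Omega) := [set u | (k.+1%:R^-1%:E <= (normc (h u))%:E)%E].
have mE k : measurable (E k).
  by rewrite -[E k]setTI; exact: emeasurable_fun_c_infty.
(* Markov's inequality. *)
have Efin k : (mu (E k) < +oo)%E.
  have k0 : 0 < k.+1%:R^-1 :> R by rewrite invr_gt0.
  have := le_integral_abse mu measurableT mEh k0; rewrite setTI.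
  have -> : [set u : borel Omega | (k.+1%:R^-1%:E <= `|(normc (h u))%:E|)%E] =
      E k.
    by apply/seteqP; split=> u; rewrite /E/= ger0_norm ?normc_ge0.
  under eq_integral do rewrite gee0_abs ?lee_fin ?normc_ge0//.
  move=> /le_lt_trans/(_ hint).
  by rewrite -lte_pdivlMl// => /lt_le_trans; apply; exact: leey.
pose F : borel Omega * 'cV[R]_n -> 'cV[R]_n := fun ux => g ux.1 *m ux.2.
have mF : measurable_fun setT F.
  apply: measurable_mulmx; last exact: measurable_snd.
  by apply: (measurableT_comp mg); exact: measurable_fst.
have mM : measurable (F @^-1` N).
  by rewrite -[X in measurable X]setTI; exact: mF.
have null k : \forall x \ae lebesgue_cV R n,
    mu (ysection (F @^-1` N) x `&` E k) = 0%E.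
  apply: (ae_null_ysection (m1 := mfrestr (mE k) (Efin k)) mM).
  have : \forall u \ae mu, E k u ->
      lebesgue_cV R n (xsection (F @^-1` N) u) = 0%E.
    apply: (@filterS3 _ _ FF) wS wh Ag => u wSu whu Agu Eku.
    have wu0 : w u != 0.
      rewrite whu//; apply: contraTneq Eku => hu0.
      by rewrite /E/= hu0 normc0 lee_fin -ltNge invr_gt0.
    have -> : xsection (F @^-1` N) u = (fun x => A u *m x) @^-1` N.
      apply/seteqP; split => x; rewrite /xsection/= inE/= /F/= Agu//;
        exact: wSu.
    by apply: lebesgue_cV_linear_null => //; exact/detA/wSu.
  (* The complement of [E k] is null for the restricted measure and can be added to the exceptional
     set. *)
  move=> [B [mB B0 sB]]; exists (B `|` ~` E k); split.
  - by apply: measurableU => //; exact: measurableC.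
  - transitivity (mu ((B `|` ~` E k) `&` E k)); first by [].
    rewrite setIUl setICl setU0.
    apply: (subset_measure0 (B := B)) => //; first exact: measurableI.
  - move=> u /= nu; have [Eu|Eu] := pselect (E k u); last by right.
    by left; apply: sB => /= /(_ Eu).
have allnull := ae_foralln null.
apply: filterS allnull => x xnull.
have Enull : \forall u \ae mu, forall k, ~ (N (F (u, x)) /\ E k u).
  apply: ae_foralln => k; exists (ysection (F @^-1` N) x `&` E k); split => //.
    by apply: measurableI => //; exact: measurable_ysection.
  by move=> u /= /contrapT; rewrite /ysection/= inE.
apply: (@filterS3 _ _ FF) (filterI wS Enull) wh Ag => u [wSu Eu] whu Agu wu0 Nu.
have hu0 : 0 < normc (h u).
  rewrite lt_neqAle normc_ge0 andbT eq_sym -whu.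
  by apply: contra_neq wu0; exact: eq0_normc.
have [k _ /(_ k (leqnn k))/= kh] := near_infty_natSinv_lt (PosNum hu0).
apply: (Eu k); rewrite /F/= -Agu; last exact: wSu.
by split => //; rewrite /E/= lee_fin ltW.
Qed.

(** * Dilations as a change of variables *)

Lemma measurable_cV_scale (R : realType) n (t : R) :
  measurable_fun setT ( *:%R t : 'cV[R]_n -> 'cV[R]_n).
Proof.
rewrite (_ : *:%R t = fun v => t *: v + 0); first exact: measurable_cV_affine.
by apply/funext => v; rewrite addr0.
Qed.

Lemma ae_dilate (R : realType) n (t : R) (P : set 'cV[R]_n) : 0 < t ->
  (\forall x \ae lebesgue_cV R n, P x) ->
  \forall x \ae lebesgue_cV R n, P (t *: x).
Proof.
move=> t0 [N [mN N0 sN]]; exists ((fun v => t *: v + 0) @^-1` N); split.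
- by rewrite -[X in measurable X]setTI; exact: measurable_cV_affine.
- have /eqP := lebesgue_cV_affine 0 t0 mN.
  by rewrite N0 mule_eq0 eqe gt_eqF ?exprn_gt0//= => /eqP.
- by move=> x /= nP; apply: sN; rewrite addr0.
Qed.

(** By [lebesgue_cV_affine] with [b = 0], the pushforward of Lebesgue measure under the dilation,
    multiplied by [t ^+ n], is Lebesgue measure again. *)
Lemma ge0_integral_dilate (R : realType) n (t : R) (D : set 'cV[R]_n)
    (f : 'cV[R]_n -> \bar R) :
  0 < t -> measurable D -> measurable_fun setT f -> (forall x, 0 <= f x)%E ->
  ((t ^+ n)%:E * \int[lebesgue_cV R n]_(x in ( *:%R t) @^-1` D) f (t *: x)%R =
   \int[lebesgue_cV R n]_(x in D) f x)%E.
Proof.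
move=> t0 mD mf f0.
have md : measurable_fun setT ( *:%R t : 'cV[R]_n -> 'cV[R]_n).
  exact: measurable_cV_scale.
have mfD : measurable_fun D f by exact: measurable_funS mf.
have tn0 : 0 <= t ^+ n by rewrite exprn_ge0// ltW.
rewrite -(ge0_integral_pushforward md)//.
rewrite -(ge0_integral_mscale _ mD (NngNum tn0) mfD)//.
apply: eq_measure_integral => E mE _.
rewrite -[RHS](lebesgue_cV_affine 0 t0 mE).
congr (_ * lebesgue_cV R n _)%E.
by apply/seteqP; split => x /=; rewrite addr0.
Qed.

(** * The localised p-th power of the norm and normalised dilations *)

Section pmass.
Variables (R : realType) (n : nat) (p : R) (p1 : 1 <= p).
Local Notation leb := (lebesgue_cV R n).
Implicit Types (D : set 'cV[R]_n) (f g : 'cV[R]_n -> R[i]).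

Let p0 : 0 < p. Proof. exact: lt_le_trans p1. Qed.

(** Over the whole space this is the p-th power of the norm ([Lp_normE]); the set [D] makes it
    possible to say where the mass of [f] sits. *)
Definition pmass D f : \bar R :=
  (\int[leb]_(x in D) ((normc (f x)) `^ p)%:E)%E.

Lemma pmass_ge0 D f : (0 <= pmass D f)%E.
Proof. by apply: integral_ge0 => x _; rewrite lee_fin powR_ge0. Qed.

Lemma measurable_pmass f : measurable_fun setT f ->
  measurable_fun setT (fun x => ((normc (f x)) `^ p)%:E).
Proof.
move=> mf; apply/measurable_EFinP; apply: (measurableT_comp (measurable_powR p)).
exact: (measurableT_comp (@measurable_normc R) mf).
Qed.

Lemma Lp_normE f : Lp_norm p f = (pmass setT f `^ p^-1)%E.
Proof.
rewrite /Lp_norm unlock; congr (poweR _ _).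
by apply: eq_integral => x _ /=; rewrite ger0_norm ?normc_ge0.
Qed.

Lemma pmass_lty f : (Lp_norm p f < +oo)%E -> (pmass setT f < +oo)%E.
Proof.
rewrite Lp_normE; apply: lty_poweRy.
by rewrite invr_eq0 gt_eqF.
Qed.

Lemma Lp_norm_lty f : (pmass setT f < +oo)%E -> (Lp_norm p f < +oo)%E.
Proof. by rewrite Lp_normE; apply: poweR_lty. Qed.

Lemma pmass_lt f (e : R) : 0 < e -> (Lp_norm p f < e%:E)%E ->
  (pmass setT f < (e `^ p)%:E)%E.
Proof.
move=> e0; rewrite Lp_normE !ltNge; apply: contra => le_ef.
have -> : e%:E = ((e `^ p)%:E `^ p^-1)%E.
  by rewrite poweR_EFin -powRrM divff ?gt_eqF// powRr1// ltW.
apply: gt0_ler_poweR => //.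
- by rewrite invr_ge0 ltW.
- by rewrite in_itv/= leey lee_fin powR_ge0.
- by rewrite in_itv/= leey pmass_ge0.
Qed.

Lemma Lp_norm_le1 f : (pmass setT f <= 1)%E -> (Lp_norm p f <= 1)%E.
Proof.
move=> f1; rewrite Lp_normE -[leRHS](poweR1r p^-1).
apply: gt0_ler_poweR => //.
- by rewrite invr_ge0 ltW.
- by rewrite in_itv/= leey pmass_ge0.
- by rewrite in_itv/= leey lee_fin ler01.
Qed.

Lemma ae_eq_pmass D f g : measurable D -> measurable_fun setT f ->
  measurable_fun setT g -> f = g %[ae leb] -> pmass D f = pmass D g.
Proof.
move=> mD mf mg fg; apply: ae_eq_integral => //.
- by apply: measurable_funTS; exact: measurable_pmass.
- by apply: measurable_funTS; exact: measurable_pmass.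
- by apply: filterS fg => x /= /(_ I) -> _.
Qed.

Lemma pmass_subset D D' f : measurable D -> measurable D' -> D `<=` D' ->
  measurable_fun setT f -> (pmass D f <= pmass D' f)%E.
Proof.
move=> mD mD' DD' mf; apply: ge0_subset_integral => //.
- by apply: measurable_funTS; exact: measurable_pmass.
- by move=> x _; rewrite lee_fin powR_ge0.
Qed.

Lemma pmass_gt0 f : measurable_fun setT f -> ~ (f = cst 0 %[ae leb]) ->
  (0 < pmass setT f)%E.
Proof.
move=> mf f0; rewrite lt_neqAle pmass_ge0 andbT eq_sym.
apply/eqP => f00; apply: f0.
have /ae_eq_integral_abs := measurable_pmass mf.
move=> /(_ leb measurableT)[+ _].
under eq_integral do rewrite gee0_abs ?lee_fin ?powR_ge0//.
move=> /(_ f00); apply: filterS => x /= /(_ I) [] /powR_eq0_eq0 fx0 _.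
exact: eq0_normc.
Qed.

(** A pointwise bound suffices: a sum of two nonnegative numbers is at most twice their maximum, and
    the p-th power of a maximum is at most the sum of the p-th powers. *)
Lemma pmass_triangle D f g : measurable D -> measurable_fun setT f ->
  measurable_fun setT g ->
  (pmass D f <= (2 `^ p)%:E * (pmass D g + pmass D (g \- f)%R))%E.
Proof.
move=> mD mf mg.
have mgf := measurable_complexB mg mf.
rewrite -ge0_integralD//; last 4 first.
- by move=> x _; rewrite lee_fin powR_ge0.
- by apply: measurable_funTS; exact: measurable_pmass.
- by move=> x _; rewrite lee_fin powR_ge0.
- by apply: measurable_funTS; exact: measurable_pmass.
rewrite -ge0_integralZl_EFin//; last 2 first.
- by move=> x _; rewrite -EFinD lee_fin addr_ge0 ?powR_ge0.
- by apply: measurable_funTS; apply: emeasurable_funD; exact: measurable_pmass.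
apply: ge0_le_integral => //.
- by move=> x _; rewrite lee_fin powR_ge0.
- by apply: measurable_funTS; exact: measurable_pmass.
- apply: measurable_funTS; apply: emeasurable_funM => //.
  by apply: emeasurable_funD; exact: measurable_pmass.
move=> x _; rewrite -EFinD -EFinM lee_fin.
set u := normc (g x); set v := normc ((g \- f) x).
have fuv : normc (f x) <= 2 * Num.max u v.
  have -> : f x = g x + (- (g \- f) x) by rewrite /= opprB addrC subrK.
  apply: le_trans (le_normcD _ _) _; rewrite normcN.
  by rewrite mulr2n mulrDl !mul1r lerD// le_max lexx ?orbT.
apply: le_trans (_ : (2 * Num.max u v) `^ p <= _).
  by apply: ge0_ler_powR; rewrite ?nnegrE ?(ltW p0) ?normc_ge0//;
    apply: le_trans fuv; exact: normc_ge0.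
rewrite powRM ?le_max ?normc_ge0// ler_pM2l ?powR_gt0//.
by case: (leP u v) => _; rewrite ?lerDl ?lerDr powR_ge0.
Qed.

Definition dilation (a t : R) f : 'cV[R]_n -> R[i] :=
  fun x => (a * (t ^+ n) `^ p^-1)%:C * f (t *: x).

Lemma measurable_dilation a t f : measurable_fun setT f ->
  measurable_fun setT (dilation a t f).
Proof.
move=> mf.
have md : measurable_fun setT ( *:%R t : 'cV[R]_n -> 'cV[R]_n).
  exact: measurable_cV_scale.
have /measurable_complexP[mr mi] := measurableT_comp mf md.
apply/measurable_complexP; split.
  rewrite (_ : _ \o _ = (fun x => a * (t ^+ n) `^ p^-1 * complex.Re (f (t *: x)))).
    exact: measurable_funM.
  by apply/funext => x; rewrite /dilation/=; case: (f _) => ? ? /=; rewrite mul0r subr0.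
rewrite (_ : _ \o _ = (fun x => a * (t ^+ n) `^ p^-1 * complex.Im (f (t *: x)))).
  exact: measurable_funM.
by apply/funext => x; rewrite /dilation/=; case: (f _) => ? ? /=; rewrite mul0r addr0.
Qed.

(** The p-th power of the normalising factor is [t ^+ n], which cancels the Jacobian; the mass that
    [f] has on [D] is moved to the shrunken set. *)
Lemma pmass_dilation a t D f : 0 < a -> 0 < t -> measurable D ->
  measurable_fun setT f ->
  pmass (( *:%R t) @^-1` D) (dilation a t f) = ((a `^ p)%:E * pmass D f)%E.
Proof.
move=> a0 t0 mD mf; have tn0 : 0 < t ^+ n by rewrite exprn_gt0.
have md : measurable_fun setT ( *:%R t : 'cV[R]_n -> 'cV[R]_n).
  exact: measurable_cV_scale.
rewrite {2}/pmass -(ge0_integral_dilate t0 mD (measurable_pmass mf)); last first.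
  by move=> x; rewrite lee_fin powR_ge0.
rewrite muleA -EFinM -ge0_integralZl_EFin//.
- apply: eq_integral => x _; rewrite /dilation normcM -EFinM; congr EFin.
  have -> : normc (a * (t ^+ n) `^ p^-1)%:C = a * (t ^+ n) `^ p^-1.
    by rewrite /= expr0n/= addr0 sqrtr_sqr ger0_norm// mulr_ge0 ?powR_ge0// ltW.
  rewrite powRM ?mulr_ge0 ?powR_ge0 ?normc_ge0 ?(ltW a0)// powRM ?powR_ge0 ?(ltW a0)//.
  by rewrite -powRrM mulVf ?gt_eqF// powRr1// ltW.
- by rewrite -[X in measurable X]setTI; exact: md.
- by move=> x _; rewrite lee_fin powR_ge0.
- apply: measurable_funTS.
  exact: (measurableT_comp (measurable_pmass mf) md).
- by rewrite mulr_ge0 ?powR_ge0// ltW.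
Qed.

End pmass.

(** * Concentration of mass on cubes around the origin *)

Section concentration.
Variables (R : realType) (n : nat) (p : R) (p1 : 1 <= p).
Local Notation leb := (lebesgue_cV R n).

Let p0 : 0 < p. Proof. exact: lt_le_trans p1. Qed.

Definition cube (r : R) : set 'cV[R]_n := [set v | forall i, `|v i ord0| < r].

Lemma measurable_cube r : measurable (cube r).
Proof.
rewrite (_ : cube r = \bigcap_(i in [set: 'I_n])
    ((fun v : 'cV[R]_n => v i ord0) @^-1` [set` `]-r, r[])); last first.
  apply/seteqP; split => v /= h i; first by rewrite /= in_itv/= -ltr_norml.
  by have := h i I; rewrite /= in_itv/= -ltr_norml.
apply: fin_bigcap_measurable => // i _; rewrite -[X in measurable X]setTI.
by apply: measurable_entry => //; exact: measurable_itv.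
Qed.

Lemma lebesgue_cube r : 0 < r -> leb (cube r) = ((2 * r) ^+ n)%:E.
Proof.
move=> r0.
have -> : cube r = [set v | forall i, [set` `]-r, r[] (v i ord0)].
  by apply/seteqP; split => v /= h i; have := h i; rewrite in_itv/= -ltr_norml.
rewrite (@lebesgue_cV_box R n (fun=> [set` `]-r, r[])); last first.
  by move=> i; exact: measurable_itv.
under eq_bigr do rewrite lebesgue_measure_itv/= lte_fin gtrN// -EFinD opprK.
by rewrite prodEFin big_const_ord iter_mulr_1 mulr2n mulrDl !mul1r.
Qed.

(** Absolute continuity of the integral, since small cubes have small measure. In dimension 0 every
    such cube is the whole one-point space, whence [0 < n]. *)
Lemma pmass_cube_small (f : 'cV[R]_n -> R[i]) (e : R) : (0 < n)%N ->
  measurable_fun setT f -> (pmass p setT f < +oo)%E -> 0 < e ->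
  exists2 r, 0 < r & (pmass p (cube r) f < e%:E)%E.
Proof.
move=> n0 mf fin e0.
have fint : leb.-integrable setT (EFin \o (fun x => (normc (f x)) `^ p)).
  apply/integrableP; split; first exact: measurable_pmass.
  by under eq_integral do rewrite gee0_abs ?lee_fin ?powR_ge0//.
have [d [d0 small]] := integral_normr_continuous fint e0.
(* Chosen so that [2 * r <= 1] and [2 * r < d]; then [(2 * r) ^+ n <= 2 * r < d]. *)
pose r := Num.min 1 d / 4.
have r0 : 0 < r by rewrite divr_gt0// lt_min ltr01.
exists r => //.
have mu_small : (leb (cube r) < d%:E)%E.
  rewrite lebesgue_cube// lte_fin.
  have r1 : 2 * r <= 1.
    have : Num.min 1 d <= 1 by rewrite ge_min lexx.
    by rewrite /r; lra.
  have rd : 2 * r < d.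
    have : Num.min 1 d <= d by rewrite ge_min lexx orbT.
    by rewrite /r; lra.
  apply: le_lt_trans rd; case: (n) n0 => // m _.
  have r2 : 0 <= 2 * r by rewrite mulr_ge0// ltW.
  by rewrite exprS; apply: ler_piMr => //; exact: exprn_ile1.
have := small _ (measurable_cube r) mu_small.
rewrite -lte_fin /Rintegral fineK.
  apply: le_lt_trans; rewrite le_eqVlt; apply/orP; left; apply/eqP.
  by apply: eq_integral => x _; rewrite ger0_norm ?powR_ge0.
rewrite ge0_fin_numE; last by apply: integral_ge0 => x _; rewrite lee_fin.
apply: le_lt_trans fin.
under eq_integral do rewrite ger0_norm ?powR_ge0//.
by apply: pmass_subset => //; exact: measurable_cube.
Qed.

(** Monotone convergence along the cubes of integer size, which exhaust the space. *)
Lemma pmass_cube_large (f : 'cV[R]_n -> R[i]) (b : \bar R) :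
  measurable_fun setT f -> (b < pmass p setT f)%E ->
  exists2 r, 0 < r & (b < pmass p (cube r) f)%E.
Proof.
move=> mf bf.
have cvg : pmass p (cube k.+1%:R) f @[k --> \oo] --> pmass p setT f.
  have -> : setT = \bigcup_k cube k.+1%:R.
    apply/esym; rewrite -subTset => v _.
    pose m := \sum_i `|v i ord0|.
    exists (Num.truncn m) => //= i.
    apply: le_lt_trans (truncnS_gt m).
    by rewrite /m (bigD1 i)//= lerDl sumr_ge0.
  apply: ge0_nondecreasing_set_cvg_integral.
  - move=> i j ij; apply/subsetPset => v /= h k.
    by apply: lt_le_trans (h k) _; rewrite ler_nat.
  - by move=> i; exact: measurable_cube.
  - by move=> i; apply: measurable_funTS; exact: measurable_pmass.
  - by move=> i x _; rewrite lee_fin powR_ge0.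
have [k bk] : exists k, (b < pmass p (cube k.+1%:R) f)%E.
  apply: contrapT => /forallNP nb.
  suff : (pmass p setT f <= b)%E by rewrite leNgt bf.
  by apply: cvge_le cvg; near=> k; rewrite leNgt; apply/negP.
by exists k.+1%:R.
Unshelve. all: by end_near. Qed.

(* Large dilations concentrate the mass near the origin, where a fixed function
   has almost none. *)
Lemma dilations_not_cluster (a : R) (f h : 'cV[R]_n -> R[i]) :
  (0 < n)%N -> 0 < a -> measurable_fun setT f -> measurable_fun setT h ->
  (pmass p setT f < +oo)%E -> (0 < pmass p setT f)%E ->
  (pmass p setT h < +oo)%E ->
  exists2 e : R, 0 < e & \forall k \near \oo,
    (e%:E <= pmass p setT (h \- dilation p a k.+1%:R f)%R)%E.
Proof.
move=> n0 a0 mf mh ffin fgt hfin.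
have ffn : pmass p setT f \is a fin_num.
  by rewrite ge0_fin_numE; [exact: ffin|exact: pmass_ge0].
pose g := fine (pmass p setT f).
have g0 : 0 < g by apply: fine_gt0; rewrite fgt ffin.
have gf : ((g / 2)%:E < pmass p setT f)%E.
  by rewrite -(fineK ffn) lte_fin -/g; lra.
have [r r0 rf] := pmass_cube_large mf gf.
(* Solves [2]^ p * (e + e) = a [^ p * (g / 2)], where the right side is a strict lower bound for the
   mass of each dilation on the shrunken cube [D]. *)
pose e := a `^ p * (g / 2) / 2 `^ p / 2.
have ap0 : 0 < a `^ p by rewrite powR_gt0.
have tp0 : 0 < 2 `^ p :> R by rewrite powR_gt0.
have e0 : 0 < e by rewrite !divr_gt0// mulr_gt0// divr_gt0.
have [s s0 sh] := pmass_cube_small n0 mh hfin e0.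
exists e; first exact: e0.
(* From this index on [k.+1 > r / s], so [D], the cube of size [r / k.+1], fits inside [cube s]. *)
exists (Num.truncn (r / s)); first by [].
move=> k /= kK.
rewrite leNgt; apply/negP => small.
have t0 : 0 < k.+1%:R :> R by [].
have md := measurable_dilation p a k.+1%:R mf.
pose D := ( *:%R (k.+1%:R : R)) @^-1` cube r.
have mD : measurable D.
  rewrite -[D]setTI; apply: measurable_cV_scale => //; exact: measurable_cube.
have Ds : D `<=` cube s.
  move=> v /= h' i; have := h' i; rewrite mxE normrM ger0_norm// mulrC.
  rewrite -ltr_pdivlMr// => /lt_le_trans; apply.
  rewrite ler_pdivrMr// mulrC -ler_pdivrMr//.
  by apply/ltW/(lt_le_trans (truncnS_gt _)); rewrite ler_nat.
(* On [D] both [h] and the difference would have mass below [e], too little for the dilation. *)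
have := pmass_triangle p1 mD md mh; rewrite leNgt => /negP; apply.
rewrite pmass_dilation//; last exact: measurable_cube.
apply: (@lt_trans _ _ ((a `^ p)%:E * (g / 2)%:E)%E); last by rewrite lte_pmul2l.
have -> : ((a `^ p)%:E * (g / 2)%:E = (2 `^ p)%:E * (e%:E + e%:E))%E.
  by rewrite -EFinD -!EFinM /e; congr EFin; field; rewrite gt_eqF.
rewrite lte_pmul2l//; apply: lteD.
  apply: le_lt_trans sh; apply: pmass_subset => //; exact: measurable_cube.
apply: le_lt_trans small; apply: pmass_subset => //.
exact: measurable_complexB.
Qed.

End concentration.

(** * The Hausdorff operator on classes and its commutation with dilations *)

Lemma Lp_repr (R : realType) n (p : R) (p1 : 1 <= p) (f : 'cV[R]_n -> R[i]) :
  measurable_fun setT f -> (Lp_norm p f < +oo)%E ->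
  exists F : Lp n p1, (F : _ -> _) = f %[ae lebesgue_cV R n].
Proof.
move=> mf fin.
pose f' : {mfun 'cV[R]_n >-> R[i]} := HB.pack f (isMeasurableFun.Build _ _ _ _ _ mf).
exists (Lp_of p1 (f := f') fin).
by have /eqmodP/asboolP : (repr (Lp_class (Lp_of p1 (f := f') fin)) = f'
  %[mod {mfun_ (lebesgue_cV R n), 'cV[R]_n >-> R[i]}])%qT by rewrite reprK.
Qed.

Lemma hausdorff_opP (R : realType) (Omega : ptopologicalType)
    (mu : {measure set (borel Omega) -> \bar R}) n (p : R) (p1 : 1 <= p)
    Phi (A : Omega -> 'M[R]_n) (F G : Lp n p1) :
  (G : _ -> _) = hausdorff mu Phi A F %[ae lebesgue_cV R n] ->
  (hausdorff_op mu Phi A F : _ -> _) = hausdorff mu Phi A F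
    %[ae lebesgue_cV R n].
Proof.
move=> GF; rewrite /hausdorff_op; set S := [set _ | _].
exact: (@xgetPex _ (Lp0 n p1) S (ex_intro _ G GF)).
Qed.

(** A value other than the default [Lp0] can only have been chosen among actual classes of the
    function [hausdorff mu Phi A F]. *)
Lemma hausdorff_op_neq0 (R : realType) (Omega : ptopologicalType)
    (mu : {measure set (borel Omega) -> \bar R}) n (p : R) (p1 : 1 <= p)
    Phi (A : Omega -> 'M[R]_n) (F : Lp n p1) :
  hausdorff_op mu Phi A F <> Lp0 n p1 ->
  (hausdorff_op mu Phi A F : _ -> _) = hausdorff mu Phi A F
    %[ae lebesgue_cV R n].
Proof.
move=> HF0; have [[G GF]|noG] := pselect (exists G : Lp n p1,
    (G : _ -> _) = hausdorff mu Phi A F %[ae lebesgue_cV R n]).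
  exact: hausdorff_opP GF.
exfalso; apply: HF0; apply: xgetPN => G GF; apply: noG; by exists G.
Qed.

(** Pointwise this is [A u *m (t *: x) = t *: (A u *m x)]. As [g] is the dilation of [f] only off a
    null set, [ae_orbit_avoids_null] is used to keep [A u *m x] out of that set. The auxiliary [w]
    is to be the kernel weighted by the determinant, whose integrability is assumed. *)
Lemma hausdorff_dilation (R : realType) (Omega : ptopologicalType) n
    (mu : {measure set (borel Omega) -> \bar R}) (p : R)
    (Phi : Omega -> R[i]) (S : set Omega) (A : Omega -> 'M[R]_n)
    (w : Omega -> R[i]) (a t : R) (f g : 'cV[R]_n -> R[i]) :
  mu_measurable mu S A -> integrableC mu [set: Omega] w ->
  (forall u, S u -> \det (A u) != 0) ->
  (\forall u \ae mu, w u != 0 -> S u) ->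
  (\forall u \ae mu, Phi u != 0 -> w u != 0) ->
  0 < a -> 0 < t ->
  g = dilation p a t f %[ae lebesgue_cV R n] ->
  hausdorff mu Phi A g = dilation p a t (hausdorff mu Phi A f)
    %[ae lebesgue_cV R n].
Proof.
move=> Am wint detA wS Phiw a0 t0 [N [mN N0 sN]].
have FF : Filter (almost_everywhere mu) by exact: ae_filter_ringOfSetsType.
have := ae_orbit_avoids_null Am wint wS detA mN N0.
apply: filterS => x xN _.
rewrite /hausdorff /dilation; apply: integralC_ae_scale.
  by rewrite mulr_gt0// powR_gt0// exprn_gt0.
apply: (@filterS2 _ _ FF) xN Phiw => u uN Phiwu.
have [->|Phi0] := eqVneq (Phi u) 0; first by rewrite !mul0r mulr0.
have -> : g (A u *m x) = dilation p a t f (A u *m x).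
  by apply: contrapT => ng; apply: (uN (Phiwu Phi0)); apply: sN => /= /(_ I).
by rewrite /dilation scalemxAr mulrCA.
Qed.

(** * Noncompactness of a nonzero Hausdorff operator *)

Theorem theorem2 (R : realType) (n : nat) (n_gt0 : (0 < n)%N)
    (p : R) (p1 : 1 <= p)
    (Omega : ptopologicalType)
    (Omega_lc : locally_compact [set: Omega]) (Omega_sc : sigma_compact Omega)
    (mu : {measure set (borel Omega) -> \bar R}) (mu_reg : regular_borel mu)
    (Phi : Omega -> R[i]) (Phi_loc : locally_integrableC mu Phi)
    (D : set Omega) (A : Omega -> 'M[R]_n)
    (A_dom : mu.-negligible (supp Phi `\` D))
    (A_meas : mu_measurable mu (supp Phi `&` D) A)
    (A_det : forall u, (supp Phi `&` D) u -> \det (A u) != 0)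
    (A_posdef : forall u, (supp Phi `&` D) u -> posdefmx (A u))
    (A_comm : forall u v, (supp Phi `&` D) u -> (supp Phi `&` D) v ->
      A u *m A v = A v *m A u)
    (Phi_int : integrableC mu [set: Omega]
      (fun u => (\det (A u) `^ (- p^-1))%:C * Phi u)) :
  (exists F : Lp n p1, hausdorff_op mu Phi A F <> Lp0 n p1) ->
  ~ compact_operator (@hausdorff_op R Omega mu n p p1 Phi A).
Proof.
move=> [F HF0].
have p0 : 0 < p := lt_le_trans ltr01 p1.
have FF : Filter (almost_everywhere mu) by exact: ae_filter_ringOfSetsType.
pose G := hausdorff_op mu Phi A F.
have GE := hausdorff_op_neq0 HF0; rewrite -/G in GE.
have Dae : \forall u \ae mu, supp Phi u -> D u.
  case: A_dom => B [mB B0 sB]; exists B; split => // u /= /not_implyP nD.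
  exact: sB.
have wS : \forall u \ae mu,
    (\det (A u) `^ (- p^-1))%:C * Phi u != 0 -> (supp Phi `&` D) u.
  apply: (@filterS _ _ FF) Dae => u Du; rewrite mulf_eq0 negb_or => /andP[_ Phi0].
  by split => //; exact: Du.
have Phiw : \forall u \ae mu, Phi u != 0 ->
    (\det (A u) `^ (- p^-1))%:C * Phi u != 0.
  apply: (@filterS _ _ FF) Dae => u Du Phi0; rewrite mulf_neq0//.
  have := A_det u (conj Phi0 (Du Phi0)).
  apply: contraNneq => -[] /powR_eq0_eq0 ->//.
have mL (K : Lp n p1) : measurable_fun setT (K : _ -> _) by exact: measurable_Lp.
have fin (K : Lp n p1) : (pmass p setT K < +oo)%E.
  by apply: pmass_lty => //; exact: Lp_finite.
(* With m the mass of [F], the dilations of [F] have mass m / (1 + m), at most 1; adding 1 keeps the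
   base positive. *)
pose a := (1 + fine (pmass p setT F)) `^ (- p^-1).
have m0 : 0 < 1 + fine (pmass p setT F).
  by rewrite ltr_pwDl// fine_ge0// pmass_ge0.
have a0 : 0 < a by rewrite powR_gt0.
have seq k : exists K : Lp n p1,
    (@hausdorff_op R Omega mu n p p1 Phi A @`
      [set F : Lp n p1 | (Lp_norm p F <= 1)%E]) K /\
    (K : _ -> _) = dilation p a k.+1%:R G %[ae lebesgue_cV R n].
  have t0 : 0 < k.+1%:R :> R by [].
  have dfin (K : Lp n p1) :
      pmass p setT (dilation p a k.+1%:R K) = ((a `^ p)%:E * pmass p setT K)%E.
    by rewrite -(pmass_dilation p1 a0 t0 measurableT (mL K)) preimage_setT.
  have dlt (K : Lp n p1) : (Lp_norm p (dilation p a k.+1%:R K) < +oo)%E.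
    by apply: Lp_norm_lty => //; rewrite dfin lte_mul_pinfty ?lee_fin ?powR_ge0.
  have [Fk FkE] := Lp_repr p1 (measurable_dilation p a k.+1%:R (mL F)) (dlt F).
  have [Gk GkE] := Lp_repr p1 (measurable_dilation p a k.+1%:R (mL G)) (dlt G).
  have HFk := hausdorff_dilation A_meas Phi_int A_det wS Phiw a0 t0 FkE.
  have HG : hausdorff mu Phi A Fk = dilation p a k.+1%:R G
      %[ae lebesgue_cV R n].
    (* [GE] is needed at the dilated point, so its null set has to be dilated too. *)
    apply: filterS2 HFk (ae_dilate t0 GE) => x /(_ I) Hx /(_ I) Gx _.
    by rewrite Hx /dilation Gx.
  (* [Gk] certifies that the image of [Fk] has a class in L^p, so [hausdorff_op] does not take its
     default value there. *)
  have GkH : (Gk : _ -> _) = hausdorff mu Phi A Fk %[ae lebesgue_cV R n].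
    by apply: filterS2 GkE HG => x /(_ I) -> /(_ I) ->.
  exists (hausdorff_op mu Phi A Fk); split; last first.
    by apply: filterS2 (hausdorff_opP GkH) HG => x /(_ I) -> /(_ I) ->.
  exists Fk => //=; apply: Lp_norm_le1 => //.
  rewrite (ae_eq_pmass _ measurableT (mL Fk) _ FkE); last exact: measurable_dilation.
  rewrite dfin -(fineK (_ : pmass p setT F \is a fin_num)); last first.
    by rewrite ge0_fin_numE ?pmass_ge0.
  rewrite -EFinM lee_fin /a -powRrM mulNr mulVf ?gt_eqF// powR_inv1 ?(ltW m0)//.
  by rewrite ler_pdivrMl// mulr1 lerDr.
have {seq}/choice[s sE] := seq.
rewrite /compact_operator precompactE => cpt.
have sX : (s @ \oo) (closure (@hausdorff_op R Omega mu n p p1 Phi A @`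
    [set F : Lp n p1 | (Lp_norm p F <= 1)%E])).
  by exists 0%N => // k _; apply: subset_closure; have [] := sE k.
(* Compactness of the closure of the image gives the sequence [s] a cluster point [H]. *)
have [H [_ clH]] := cpt _ (fmap_proper_filter s _) sX.
have G0 : (0 < pmass p setT G)%E.
  apply: pmass_gt0 => // GE0; apply: HF0; apply/LpP.
  by apply: filterS2 GE0 (Lp0E n p1) => x /(_ I) -> /(_ I) ->.
have [e e0 eK] := dilations_not_cluster p1 n_gt0 a0 (mL G) (mL H) (fin G) G0 (fin H).
have e'0 : 0 < e `^ p^-1 by rewrite powR_gt0.
have [K [sK HK]] : (s @` [set k |
    (e%:E <= pmass p setT (H \- dilation p a k.+1%:R G)%R)%E] `&`
    ball H (e `^ p^-1)) !=set0.
  apply: clH; last exact: nbhsx_ballx.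
  by apply: filterS eK => k ek; exists k.
case: sK HK => k /= ek <- /(pmass_lt p1 e'0).
rewrite -powRrM mulVf ?gt_eqF// powRr1 ?(ltW e0)// ltNge => /negP; apply.
rewrite (ae_eq_pmass p measurableT _ _ (g := H \- dilation p a k.+1%:R G))//.
- exact: measurable_complexB.
- by apply: measurable_complexB => //; exact: measurable_dilation.
- by have [_] := sE k; apply: filterS => x /= /(_ I) -> _.
Qed.
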